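(* Let $\mathcal{H}$ be a real Hilbert space, let $T:\mathcal{H}\to\mathcal{H}$ be a continuous linear self-adjoint operator, let $T_1:\mathcal{H}\to\mathcal{H}$ be a positive semidefinite continuous linear self-adjoint operator, and let $c,c_1\in\mathcal{H}$, $\alpha_1\in\mathbb{R}$. Put $f(x)=\frac12\langle x,Tx\rangle+\langle c,x\rangle$, $g_1(x)=\frac12\langle x,T_1x\rangle+\langle c_1,x\rangle+\alpha_1$ and $F=\{x\in\mathcal{H}\mid g_1(x)\leqslant 0\}$. Suppose that $\langle x,Tx\rangle$ is a Legendre form, that $F$ is nonempty, and that $f$ is bounded from below over $F$. Then the problem of minimizing $f(x)$ subject to $x\in F$ has an optimal solution, i.e. there is $\bar x\in F$ with $f(\bar x)\leqslant f(x)$ for all $x\in F$.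
   Context: A continuous linear self-adjoint operator $S$ on $\mathcal{H}$ is positive semidefinite if $\langle x,Sx\rangle\geqslant 0$ for all $x\in\mathcal{H}$. A continuous quadratic form $Q(x)=\langle x,Tx\rangle$ on $\mathcal{H}$ is a Legendre form if (a) $Q$ is weakly lower semicontinuous, and (b) $x_k\to x_0$ strongly whenever $x_k\rightharpoonup x_0$ (weak convergence) and $Q(x_k)\to Q(x_0)$. *)

(* Defs.v *)
From mathcomp Require Import all_boot all_order all_algebra.
From mathcomp Require Import all_classical all_reals all_analysis.

Set Implicit Arguments.
Unset Strict Implicit.
Unset Printing Implicit Defensive.

Import Order.TTheory GRing.Theory Num.Theory.
Import numFieldNormedType.Exports.

Local Open Scope classical_set_scope.
Local Open Scope ring_scope.

(* A real Hilbert space is a complete normed module [H] over a [realType]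
   with a positive definite symmetric bilinear form [dot : {dot H for idfun}]
   that induces the norm of [H], see [induces_norm]. *)
Section Hilbert.
Variables (R : realType) (H : completeNormedModType R).
Variable dot : {dot H for idfun}.

Definition induces_norm := forall x : H, `|x| ^+ 2 = dot x x.

Definition self_adjoint (S : H -> H) := forall x y, dot (S x) y = dot x (S y).

Definition positive_semidefinite (S : H -> H) := forall x, 0 <= dot x (S x).

Definition weakly_cvg_to (u : nat -> H) (x : H) :=
  forall y, dot (u k) y @[k --> \oo] --> dot x y.

(* Weak lower semicontinuity is taken along weakly convergent sequences. *)
Definition weakly_lower_semicontinuous (Q : H -> R) :=
  forall (u : nat -> H) (x : H), weakly_cvg_to u x ->
  ((Q x)%:E <= limn_einf (fun k => (Q (u k))%:E))%E.

Definition quadratic_form (T : H -> H) (x : H) : R := dot x (T x).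

(* To be used for a quadratic form [Q] that is already known to be continuous
   (for instance [quadratic_form T] with [T] linear and continuous). *)
Definition legendre_form (Q : H -> R) :=
  weakly_lower_semicontinuous Q /\
  forall (u : nat -> H) (x : H), weakly_cvg_to u x ->
    Q (u k) @[k --> \oo] --> Q x -> u k @[k --> \oo] --> x.

End Hilbert.

(* Main.v *)
Require Import Defs.
From mathcomp Require Import all_boot all_order all_algebra.
From mathcomp Require Import all_classical all_reals all_analysis.
From mathcomp Require Import ring lra.

Import Order.TTheory GRing.Theory Num.Theory.
Import numFieldNormedType.Exports.

Local Open Scope classical_set_scope.
Local Open Scope ring_scope.

(** Write Q x = <x, T x> and Q1 x = <x, T1 x>, so that
    f x = Q x / 2 + <c, x>.

    The direct method settles the case of a bounded minimizing sequence: a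
    subsequence converges weakly (bounded_weak_subsequence), F is weakly
    closed because Q1, being positive semidefinite, is weakly lower
    semicontinuous (sublevel_weakly_closed), and so is f by the Legendre
    hypothesis.

    If no minimizing sequence is bounded, take points y_k of F with f (y_k)
    bounded, |y_k| tending to infinity, and |y_k|^2 within 1 of the least
    squared norm on the part of F where f <= f (y_k).  A subsequence of
    y_k / |y_k| converges weakly to some v, which is a recession direction
    of F.  Boundedness from below along v gives Q v >= 0, whereas
    Q (y_k / |y_k|) is at most a sequence tending to 0; hence Q v = 0 and the
    Legendre property makes the convergence strong, so |v| = 1.  Moving back
    from y_k along v does not increase f, since <T y_k + c, v> >= 0, and
    lowers the norm by almost 1.  So y_k - v cannot lie in F for all k.
    This is legendre_minimizer_or_recession.

    In the remaining case v is a recession direction with Q v = 0 that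
    leaves F when followed backwards.  Then T1 v = 0 and <c1, v> < 0, so
    every line of direction v meets F, which forces T v = 0 and <c, v> >= 0.
    With l = <c, v> / - <c1, v> >= 0, the Lagrangian L = f + l g1 is constant
    along v, and sliding any point y along v to the boundary g1 = 0 turns
    the value L y into a value of f on F.  Hence L is bounded from below on
    the whole space.  Its quadratic part Q + l Q1 is again a Legendre form
    (legendre_formD), and the whole space is invariant under all
    translations, so the dichotomy above provides a minimizer of L.  Slid to
    g1 = 0, it is a minimizer of f over F, because f >= L on F. *)

(** * Real inequalities and limits *)

Section RealFacts.
Variable (R : realType).

Lemma affine_ge_slope (a b m : R) :
  (forall t, 0 <= t -> m <= a + t * b) -> 0 <= b.
Proof.
move=> h; rewrite leNgt; apply/negP => b0.
(* The value at this t is a - |a - m| - 1, at most m - 1. *)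
have := h ((`|a - m| + 1) / - b) _.
have -> : (`|a - m| + 1) / - b * b = - (`|a - m| + 1) by field; lra.
have := ler_norm (a - m).
move=> h1 h2; have /h2 : 0 <= (`|a - m| + 1) / - b.
  by apply: divr_ge0; rewrite ?addr_ge0 //; lra.
lra.
Qed.

Lemma quadratic_ge_curvature (a b q m : R) :
  (forall t, 0 <= t -> m <= a + t * b + t ^+ 2 * q) -> 0 <= q.
Proof.
move=> h; apply: (@affine_ge_slope q q (- b - `|m - a|)) => t t0.
have t1 : 0 < t + 1 by lra.
have := h _ (ltW t1); have := ler_norm (a - m); rewrite distrC => hn hq.
rewrite -(ler_pM2l t1); have := normr_ge0 (m - a); nra.
Qed.

Lemma quadratic_ge0_slope (b q : R) :
  (forall t, 0 <= t * b + t ^+ 2 * q) -> b = 0.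
Proof.
move=> h.
have key c : (forall t, 0 <= t * c + t ^+ 2 * q) -> 0 <= c.
  move=> hc; apply: (@affine_ge_slope (c + q) c 0) => s s0.
  have s1 : 0 < s + 1 by lra.
  have := hc (s + 1)^-1.
  have -> : (s + 1)^-1 * c + (s + 1)^-1 ^+ 2 * q =
            (s + 1)^-1 ^+ 2 * (c + q + s * c) by field; lra.
  by rewrite pmulr_rge0 // exprn_gt0 // invr_gt0.
have hN : 0 <= - b.
  by apply: key => t; have := h (- t); rewrite sqrrN mulNr mulrN.
by have := key _ h; lra.
Qed.

Lemma cvg_ge {S : Type} {F : set_system S} {FF : ProperFilter F}
    (u : S -> R) (l m : R) :
  u k @[k --> F] --> l -> (\forall k \near F, m <= u k) -> m <= l.
Proof.
move=> ul mu; rewrite -(cvg_lim (@Rhausdorff R) ul).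
by apply: limr_ge => //; apply/cvg_ex; exists l.
Qed.

(** A cluster point of an ultrafilter is a limit, and the segment [-M, M] is
    compact. *)
Lemma bounded_ultra_cvg {S : Type} {U : set_system S} (UU : UltraFilter U)
    (r : S -> R) (M : R) :
  (forall k, `|r k| <= M) -> exists l : R, r k @[k --> U] --> l.
Proof.
move=> rM; have PU : ProperFilter U by exact: ultra_proper.
have rseg : (r k @[k --> U]) `[- M, M]%classic.
  by apply: nearW => k /=; rewrite in_itv /= -ler_norml.
have [l [_ lcl]] := segment_compact (fmap_proper_filter r PU) rseg.
exists l => A lA.
have [//|UnA] := in_ultra_setVsetC (r @^-1` A) UU.
by have [z [/= nAz Az]] := lcl (~` A) A UnA lA.
Qed.

End RealFacts.

(** * Inner products *)

Section DotProduct.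
Context {R : realType} {H : completeNormedModType R}.
Variable dot : {dot H for idfun}.
Hypothesis dot_norm : induces_norm dot.

Lemma dotC x y : dot x y = dot y x.
Proof. by rewrite hermC expr0 mul1r. Qed.

Lemma dotDr x y z : dot x (y + z) = dot x y + dot x z.
Proof. exact: linearDr. Qed.

Lemma dotZr x a z : dot x (a *: z) = a * dot x z.
Proof. exact: linearZr_LR. Qed.

Lemma dotDl x y z : dot (y + z) x = dot y x + dot z x.
Proof. exact: linearDl. Qed.

Lemma dotZl x a z : dot (a *: z) x = a * dot z x.
Proof. by rewrite dotC dotZr dotC. Qed.

Lemma dotNr x z : dot x (- z) = - dot x z.
Proof. by rewrite -scaleN1r dotZr mulN1r. Qed.

Lemma dotNl x z : dot (- z) x = - dot z x.
Proof. by rewrite dotC dotNr dotC. Qed.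

Lemma dot0r x : dot x 0 = 0.
Proof. by rewrite -(scale0r 0) dotZr mul0r. Qed.

Let dotE := (dotDl, dotDr, dotZl, dotZr, dotNl, dotNr).

Lemma dot_ge0 x : 0 <= dot x x.
Proof. by rewrite -dot_norm sqr_ge0. Qed.

Lemma dot_eq0 x : dot x x = 0 -> x = 0.
Proof. by rewrite -dot_norm => /eqP; rewrite sqrf_eq0 normr_eq0 => /eqP. Qed.

Lemma cauchy_schwarz x y : `|dot x y| <= `|x| * `|y|.
Proof.
have key u v : dot u v <= `|u| * `|v|.
  have [->|v0] := eqVneq v 0; first by rewrite dot0r normr0 mulr0.
  have [->|u0] := eqVneq u 0; first by rewrite dotC dot0r normr0 mul0r.
  have p : 0 < `|u| * `|v| by rewrite mulr_gt0 ?normr_gt0.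
  have := dot_ge0 (`|v| *: u - `|u| *: v).
  rewrite !dotE -!dot_norm (dotC v u) => h.
  rewrite -(ler_pM2l p); nra.
rewrite ler_norml key andbT lerNl -dotNr (le_trans (key _ _)) //.
by rewrite normrN.
Qed.

Lemma dot_cvgl (u : nat -> H) x y :
  u k @[k --> \oo] --> x -> dot (u k) y @[k --> \oo] --> dot x y.
Proof.
move=> ux; apply/cvgrPdist_lt => e e0.
have e1 : 0 < e / (`|y| + 1) by rewrite divr_gt0 // ltr_wpDl.
move/cvgrPdist_lt/(_ _ e1): ux; apply: filterS => k.
rewrite ltr_pdivlMr ?ltr_wpDl // => h.
rewrite -dotNl -dotDl (le_lt_trans (cauchy_schwarz _ _)) //.
apply: le_lt_trans h; rewrite ler_wpM2l // lerDl ler01 //.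
Qed.

(** * Riesz representation and weak compactness *)

(** Minimizing J y = <y, y> - 2 phi y over V handles two classical results at
    once: for V the whole space this is the Riesz theorem, and for
    phi = <., a> the minimizer is the orthogonal projection of a on V.  By
    the parallelogram identity a minimizing sequence is Cauchy, and the
    first variation of J vanishes at its limit. *)
Lemma riesz (V : set H) (phi : H -> R) (M : R) :
  V 0 -> (forall a x y, V x -> V y -> V (a *: x + y)) ->
  (forall (w : nat -> H) y, (forall n, V (w n)) ->
     w n @[n --> \oo] --> y -> V y) ->
  scalar phi -> (forall y, `|phi y| <= M * `|y|) ->
  exists2 x, V x & forall y, V y -> dot x y = phi y.
Proof.
move=> V0 Vlin Vcl phil phiM.
pose J y := dot y y - 2 * phi y.
have infJ : has_inf [set J y | y in V].
  split; first by exists (J 0), 0.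
  exists (- M ^+ 2) => _ [y _ <-]; rewrite /J -dot_norm.
  have := phiM y; rewrite ler_norml => /andP[_ h].
  have := sqr_ge0 (`|y| - M); nra.
pose m := inf [set J y | y in V].
have mJ y : V y -> m <= J y.
  by move=> Vy; apply: ge_inf; [exact: infJ.2 | exists y].
have /choice[w wP] : forall n : nat, exists y, V y /\ J y < m + harmonic n.
  move=> n.
  have [_ [y Vy <-] h] := inf_adherent (@harmonic_gt0 R n) infJ.
  by exists y.
have phi0 : phi 0 = 0 by have := phil (-1) 0 0; rewrite scaler0 addr0; lra.
have phiD x y : phi (x + y) = phi x + phi y.
  by rewrite -{1}(scale1r x) phil mul1r.
have phiZ a x : phi (a *: x) = a * phi x.
  by rewrite -{1}(addr0 (a *: x)) phil phi0 addr0.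
have w_close n p : `|w n - w p| ^+ 2 <= 2 * (harmonic n + harmonic p).
  have [[Vn Jn] [Vp Jp]] := (wP n, wP p).
  have Vmid : V (2^-1 *: w n + 2^-1 *: w p).
    by apply: (Vlin) => //; rewrite -(addr0 (2^-1 *: _)); exact: Vlin.
  (* |w n - w p|^2 / 2 = J (w n) + J (w p) - 2 J ((w n + w p) / 2). *)
  have := mJ _ Vmid; move: Jn Jp.
  rewrite /J dot_norm !dotE phiD !phiZ (dotC (w p) (w n)); lra.
have /cvg_ex[/= x wx] : cvg (w n @[n --> \oo]).
  apply: cauchy_cvg; apply: cauchy_exP => e e0.
  have [N _ Nh] : \forall n \near \oo, harmonic n < e ^+ 2 / 4.
    have e4 : 0 < e ^+ 2 / 4 by rewrite divr_gt0 // exprn_gt0.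
    exact: (near_infty_natSinv_lt (PosNum e4)).
  exists (w N), N => // n Nn /=.
  rewrite -ball_normE /= -(@ltr_pXn2r _ 2) ?nnegrE ?(ltW e0) //.
  have hN : harmonic N < e ^+ 2 / 4 := Nh _ (leqnn N).
  have hn : harmonic n < e ^+ 2 / 4 := Nh _ Nn.
  have := w_close N n; lra.
exists x; first by apply: Vcl wx => n; have [] := wP n.
move=> y Vy; apply/eqP; rewrite -subr_eq0; apply/eqP.
suff : 2 * (dot x y - phi y) = 0 by lra.
apply: (@quadratic_ge0_slope _ _ (dot y y)) => t.
have limJ : (harmonic n + (t * (2 * (dot (w n) y - phi y)) + t ^+ 2 * dot y y))
    @[n --> \oo] --> 0 + (t * (2 * (dot x y - phi y)) + t ^+ 2 * dot y y).
  apply: cvgD; first exact: cvg_harmonic.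
  apply: cvgD; last exact: cvg_cst.
  apply: cvgM; first exact: cvg_cst.
  apply: cvgM; first exact: cvg_cst.
  apply: cvgB; last exact: cvg_cst.
  exact: dot_cvgl.
rewrite -(add0r (_ + _)); apply: cvg_ge limJ _.
apply: nearW => n.
have [Vn Jn] := wP n.
have := mJ _ (Vlin t _ _ Vy Vn); move: Jn.
rewrite /J !dotE phiD !phiZ (dotC y (w n)); nra.
Qed.

(** The limits of <u k, y> along an ultrafilter form a bounded linear
    functional of y, represented by some x.  As finitely many of these
    scalar limits can be approximated simultaneously, there are indices s n
    with <u (s n), y> -> <x, y> for y = x and for each y = u j.  The set V of
    all y with this property is a closed subspace, and the projection on V
    extends the convergence to every y. *)
Lemma bounded_weak_subsequence (u : nat -> H) (M : R) :
  (forall k, `|u k| <= M) ->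
  exists (s : nat -> nat) (x : H),
    (forall k, (k <= s k)%N) /\ weakly_cvg_to dot (u \o s) x.
Proof.
move=> uM.
have [U [UU oU]] := ultraFilterLemma eventually_filter.
have PU : ProperFilter U by exact: ultra_proper.
have /choice[phi phiP] : forall y, exists l : R, dot (u k) y @[k --> U] --> l.
  move=> y; apply: (bounded_ultra_cvg R UU _ (M * `|y|)) => k.
  by rewrite (le_trans (cauchy_schwarz _ _)) ?ler_wpM2r.
have phi_scalar : scalar phi.
  move=> a y z; apply: (cvg_unique (@Rhausdorff R) (phiP _)).
  have -> : (fun k => dot (u k) (a *: y + z)) =
            (fun k => a * dot (u k) y + dot (u k) z).
    by apply/funext => k; rewrite !dotE.
  by apply: cvgD => //; apply: cvgM => //; exact: cvg_cst.
have phi_bounded y : `|phi y| <= M * `|y|.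
  have h : M * `|y| - `|dot (u k) y| @[k --> U] --> M * `|y| - `|phi y|.
    by apply: cvgB; [exact: cvg_cst | exact: cvg_norm].
  rewrite -subr_ge0; apply: cvg_ge h _; apply: nearW => k; rewrite subr_ge0.
  by rewrite (le_trans (cauchy_schwarz _ _)) ?ler_wpM2r.
have [x _ xphi] : exists2 x, [set: H] x & forall y, [set: H] y -> dot x y = phi y.
  by apply: (riesz _ _ M).
have Ux y : dot (u k) y @[k --> U] --> dot x y by rewrite xphi.
have /choice[s sP] : forall n : nat, exists k, [/\ (n <= k)%N,
    `|dot x x - dot (u k) x| < harmonic n &
    forall j : 'I_n, `|dot x (u j) - dot (u k) (u j)| < harmonic n].
  move=> n; apply: (@filter_ex _ U).
  have Un y : \forall k \near U, `|dot x y - dot (u k) y| < harmonic n.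
    by move/cvgrPdist_lt: (Ux y) => /(_ _ (harmonic_gt0 n)).
  have Uall : \forall k \near U, forall j : 'I_n,
      `|dot x (u j) - dot (u k) (u j)| < harmonic n.
    by apply: filter_forall => j; exact: Un.
  by apply: filterS3 (oU _ (nbhs_infty_ge n)) (Un x) Uall => k *; split.
have h0 (r : nat -> R) l : (\forall n \near \oo, `|l - r n| < harmonic n) ->
    r n @[n --> \oo] --> l.
  move=> rl; apply/cvgrPdist_lt => e e0.
  apply: filterS2 rl (near_infty_natSinv_lt (PosNum e0)) => n.
  exact: lt_trans.
pose V := [set y | dot (u (s n)) y @[n --> \oo] --> dot x y].
have Vx : V x by apply: h0; apply: nearW => n; have [] := sP n.
have Vu j : V (u j).
  apply: h0; apply: filterS (nbhs_infty_gt j) => n jn.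
  by have [_ _ /(_ (Ordinal jn))] := sP n.
have V0 : V 0.
  by rewrite /V /=; under eq_fun do rewrite dot0r; rewrite dot0r; exact: cvg_cst.
have Vlin a y z : V y -> V z -> V (a *: y + z).
  rewrite /V /= => Vy Vz; under eq_fun do rewrite !dotE; rewrite !dotE.
  by apply: cvgD => //; apply: cvgM => //; exact: cvg_cst.
have Vcl (w : nat -> H) y :
    (forall n, V (w n)) -> w n @[n --> \oo] --> y -> V y.
  move=> Vw wy; apply/cvgrPdist_lt => e e0.
  have M0 : 0 <= M by exact: le_trans (uM 0%N).
  pose C := 2 * (M + `|x| + 1).
  have C0 : 0 < C by rewrite /C; have := normr_ge0 x; lra.
  have eC : 0 < e / C by rewrite divr_gt0.
  move/cvgrPdist_lt/(_ _ eC): wy => /filter_ex[m].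
  rewrite ltr_pdivlMr // => wm.
  have e2 : 0 < e / 2 by rewrite divr_gt0.
  move/cvgrPdist_lt/(_ _ e2): (Vw m); apply: filterS => n hn.
  have -> : dot x y - dot (u (s n)) y =
     (dot x (w m) - dot (u (s n)) (w m)) + dot (x - u (s n)) (y - w m).
    by rewrite !dotE; ring.
  apply: (le_lt_trans (ler_normD _ _)).
  have := cauchy_schwarz (x - u (s n)) (y - w m).
  have : `|x - u (s n)| <= `|x| + M.
    by rewrite (le_trans (ler_normB _ _)) // lerD2l.
  have := normr_ge0 (y - w m); rewrite /C in wm; nra.
exists s, x; split=> [k|y]; first by have [] := sP k.
(* On the projection z of y the limit is known, and y may be replaced by z
   because x and all the u (s n) belong to V. *)
have [z Vz zy] : exists2 z, V z & forall v, V v -> dot z v = dot y v.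
  apply: (riesz _ _ `|y|) => //.
  - by move=> a v w; rewrite !dotE.
  - exact: cauchy_schwarz.
rewrite (dotC x) -zy // (dotC z); move: Vz; rewrite /V /=.
suff -> : (fun n => dot (u (s n)) z) = (fun n => dot ((u \o s) n) y) by [].
by apply/funext => n /=; rewrite (dotC _ y) -zy // dotC.
Qed.

(** * Weak lower semicontinuity and Legendre forms *)

Lemma weakly_lsc_near (Q : H -> R) : weakly_lower_semicontinuous dot Q <->
  forall (u : nat -> H) x e, weakly_cvg_to dot u x -> 0 < e ->
    \forall k \near \oo, Q x - e < Q (u k).
Proof.
have supE (u : nat -> H) : limn_einf (fun k => (Q (u k))%:E) =
    ereal_sup (range (einfs (fun k => (Q (u k))%:E))).
  by rewrite limn_einf_lim; apply: cvg_lim => //; exact: cvg_einfs_sup.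
split=> [Qlsc u x e ux e0|Qnear u x ux].
  have : ((Q x - e)%:E < limn_einf (fun k => (Q (u k))%:E))%E.
    by apply: lt_le_trans (Qlsc _ _ ux); rewrite lte_fin ltrBlDr ltrDl.
  rewrite supE => /ereal_sup_gt[_ [n _ <-]] h.
  exists n => // k /= nk; rewrite -lte_fin (lt_le_trans h) //.
  by apply: ereal_inf_lbound; exists k.
apply/lee_subgt0Pr => e e0; rewrite supE.
have [n _ nP] := Qnear u x e ux e0.
apply: (@le_trans _ _ (einfs (fun k => (Q (u k))%:E) n)); last first.
  by apply: ereal_sup_ubound; exists n.
by apply: le_ereal_inf_tmp => _ [k /= nk <-]; rewrite -EFinB lee_fin ltW // nP.
Qed.

Lemma weakly_lsc_le (Q : H -> R) (u : nat -> H) (x : H) (a : nat -> R) (l : R) :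
  weakly_lower_semicontinuous dot Q -> weakly_cvg_to dot u x ->
  (\forall k \near \oo, Q (u k) <= a k) -> a k @[k --> \oo] --> l -> Q x <= l.
Proof.
move=> /weakly_lsc_near Qlsc ux Qa al; apply/ler_addgt0Pr => e e0.
rewrite -lerBlDr; apply: cvg_ge al _.
by apply: filterS2 (Qlsc _ _ _ ux e0) Qa => k /ltW; exact: le_trans.
Qed.

(** Semicontinuity bounds Q (u k) from below near Q x, and [a] bounds it
    from above. *)
Lemma weakly_lsc_cvg (Q : H -> R) (u : nat -> H) (x : H) (a : nat -> R) :
  weakly_lower_semicontinuous dot Q -> weakly_cvg_to dot u x ->
  (forall k, Q (u k) <= a k) -> a k @[k --> \oo] --> Q x ->
  Q (u k) @[k --> \oo] --> Q x.
Proof.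
move=> /weakly_lsc_near Qlsc ux Qa al; apply/cvgrPdist_lt => e e0.
move/cvgrPdist_lt/(_ _ e0): al; apply: filterS2 (Qlsc _ _ _ ux e0) => k.
by rewrite !ltr_norml => h /andP[h1 h2]; apply/andP; split; have := Qa k; lra.
Qed.

(** The form is nonnegative and vanishes at x, so its derivative
    y |-> 2 <S x, y> at x vanishes too. *)
Lemma psd_kernel (S : {linear H -> H}) x : self_adjoint dot S ->
  positive_semidefinite dot S -> dot x (S x) = 0 -> S x = 0.
Proof.
move=> Ssa Spsd Sx; apply: dot_eq0.
suff : 2 * dot (S x) (S x) = 0 by lra.
apply: (@quadratic_ge0_slope _ _ (dot (S x) (S (S x)))) => t.
have := Spsd (x + t *: S x).
by rewrite linearD linearZ /= !dotE Sx -(Ssa x (S x)); nra.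
Qed.

(** Expanding <u k - x, S (u k - x)> >= 0 bounds the form at u k from below
    by 2 <u k, S x> - <x, S x>, which depends weakly continuously on u k. *)
Lemma psd_weakly_lsc (S : {linear H -> H}) : self_adjoint dot S ->
  positive_semidefinite dot S ->
  weakly_lower_semicontinuous dot (quadratic_form dot S).
Proof.
move=> Ssa Spsd; apply/weakly_lsc_near => u x e ux e0.
have e2 : 0 < e / 2 by rewrite divr_gt0.
move/cvgrPdist_lt/(_ _ e2): (ux (S x)); apply: filterS => k.
rewrite ltr_norml /quadratic_form => /andP[_ h].
have := Spsd (u k - x); rewrite linearB /= !dotE -(Ssa x (u k)) (dotC (S x)).
lra.
Qed.

(** Both summands are weakly lower semicontinuous, so convergence of the
    values of the sum forces convergence of the values of each summand; the
    Legendre property of the first one then applies. *)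
Lemma legendre_formD (S S' : {linear H -> H}) (l : R) : 0 <= l ->
  legendre_form dot (quadratic_form dot S) ->
  self_adjoint dot S' -> positive_semidefinite dot S' ->
  legendre_form dot (quadratic_form dot (S \+ (l \*: S'))).
Proof.
move=> l0 [Slsc SL] S'sa S'psd.
have S'lsc := psd_weakly_lsc S' S'sa S'psd.
have QE x : quadratic_form dot (S \+ (l \*: S')) x =
    quadratic_form dot S x + l * quadratic_form dot S' x.
  by rewrite /quadratic_form /= !dotE.
have l1 : 0 < l + 1 by lra.
have both u x e : weakly_cvg_to dot u x -> 0 < e -> \forall k \near \oo,
    quadratic_form dot S x - e < quadratic_form dot S (u k) /\
    l * quadratic_form dot S' x - e <= l * quadratic_form dot S' (u k).
  move=> ux e0; have e1 : 0 < e / (l + 1) by rewrite divr_gt0.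
  move/weakly_lsc_near/(_ _ _ _ ux e0): Slsc => h.
  move/weakly_lsc_near/(_ _ _ _ ux e1): S'lsc => h'.
  apply: filterS2 h h' => k h h'; split=> //.
  (* The denominator l + 1 covers the case l = 0 as well. *)
  have e1E : e = (l + 1) * (e / (l + 1)) by field; lra.
  by move: e1 h' e1E; set d := e / _ => e1 h' ->; nra.
split.
  apply/weakly_lsc_near => u x e ux e0.
  have e2 : 0 < e / 2 by rewrite divr_gt0.
  by apply: filterS (both _ _ _ ux e2) => k [? ?]; rewrite !QE; lra.
move=> u x ux cv; apply: SL => //; apply/cvgrPdist_lt => e e0.
have e2 : 0 < e / 2 by rewrite divr_gt0.
move/cvgrPdist_lt/(_ _ e2): cv; apply: filterS2 (both _ _ _ ux e2) => k [h h'].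
by rewrite !QE !ltr_norml => /andP[? ?]; apply/andP; split; lra.
Qed.

(** * Minimization over weakly closed convex sets *)

(** Closedness along sequences; membership is required of the terms of large
    index only, so that finitely many terms may be discarded. *)
Definition weakly_closed (F : set H) := forall (u : nat -> H) x,
  weakly_cvg_to dot u x -> (\forall k \near \oo, F (u k)) -> F x.

Definition convex (F : set H) := forall x y t, F x -> F y ->
  0 <= t <= 1 -> F ((1 - t) *: x + t *: y).

Definition recession_direction (F : set H) v := forall x t, F x ->
  0 <= t -> F (x + t *: v).

Lemma large_norm_inv (y : nat -> H) : (forall k, k.+1%:R <= `|y k|) ->
  `|y k|^-1 @[k --> \oo] --> 0.
Proof.
move=> yk; apply: (squeeze_cvgr _ (cvg_cst 0) cvg_harmonic).
apply: nearW => k; rewrite invr_ge0 normr_ge0 /= lef_pV2 ?posrE //.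
exact: lt_le_trans (yk k).
Qed.

(** For x in F, the point x + t v is the weak limit of the convex combinations
    of x and y k with weight t / |y k| on y k. *)
Lemma asymptotic_recession (F : set H) (y : nat -> H) v :
  weakly_closed F -> convex F -> (forall k, F (y k)) ->
  (forall k, k.+1%:R <= `|y k|) ->
  weakly_cvg_to dot (fun k => `|y k|^-1 *: y k) v -> recession_direction F v.
Proof.
move=> Fcl Fcv Fy yk yv x t Fx t0.
have y0 := large_norm_inv y yk.
have ty0 : t * `|y k|^-1 @[k --> \oo] --> 0.
  by rewrite -(mulr0 t); apply: cvgM => //; exact: cvg_cst.
apply: (Fcl (fun k => (1 - t * `|y k|^-1) *: x + (t * `|y k|^-1) *: y k)).
  move=> z.
  have -> : dot (x + t *: v) z = (1 - 0) * dot x z + t * dot v z.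
    by rewrite !dotE; ring.
  under eq_fun => k do rewrite !dotE -mulrA -(dotZl z `|y k|^-1).
  apply: cvgD; last by apply: cvgM; [exact: cvg_cst | exact: yv].
  apply: cvgM; last exact: cvg_cst.
  by apply: cvgB => //; exact: cvg_cst.
move/cvgrPdist_lt/(_ 1 ltr01): ty0; apply: filterS => k.
rewrite sub0r normrN => /(le_lt_trans (ler_norm _)) /ltW h.
by apply: Fcv => //; rewrite h andbT mulr_ge0 ?invr_ge0.
Qed.

Definition quadratic_function (S : H -> H) (b x : H) : R :=
  2^-1 * dot x (S x) + dot b x.

Lemma quadratic_functionD (S : {linear H -> H}) b x v t : self_adjoint dot S ->
  quadratic_function S b (x + t *: v) = quadratic_function S b x +
    t * dot (S x + b) v + t ^+ 2 * (2^-1 * quadratic_form dot S v).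
Proof.
move=> Ssa; rewrite /quadratic_function /quadratic_form linearD linearZ /= !dotE.
by rewrite -(Ssa x v) (dotC v (S x)); field.
Qed.

Lemma bounded_minimizing_sequence (S : H -> H) b (F : set H) (y : nat -> H) m M :
  weakly_lower_semicontinuous dot (quadratic_form dot S) -> weakly_closed F ->
  (forall k, F (y k)) -> (forall k, `|y k| <= M) ->
  (forall k, quadratic_function S b (y k) <= m + harmonic k) ->
  exists2 x, F x & quadratic_function S b x <= m.
Proof.
move=> Slsc Fcl Fy yM ym.
have [s [x [ks sx]]] := bounded_weak_subsequence y M yM.
exists x; first by apply: (Fcl _ _ sx); apply: nearW => k; exact: Fy.
suff : quadratic_form dot S x <= 2 * (m + 0 - dot b x).
  by rewrite /quadratic_function /quadratic_form; lra.
apply: (weakly_lsc_le _ _ _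
  (fun k => 2 * (m + harmonic k - dot b (y (s k)))) _ Slsc sx).
  apply: nearW => k; have := ym (s k); rewrite /quadratic_function /quadratic_form /comp.
  have : harmonic (s k) <= harmonic k :> R.
    by rewrite lef_pV2 ?posrE // ler_nat ltnS.
  lra.
apply: cvgM; first exact: cvg_cst.
apply: cvgB; first by apply: cvgD; [exact: cvg_cst | exact: cvg_harmonic].
by rewrite dotC; under eq_fun do rewrite dotC; exact: sx.
Qed.

(** The least norm on [A] need not be attained; the slack 1 is harmless on
    points whose norm tends to infinity. *)
Lemma almost_minimal_norm (A : set H) : A !=set0 ->
  exists2 y, A y & forall z, A z -> dot y y <= dot z z + 1.
Proof.
move=> [a Aa]; pose E := [set dot z z | z in A].
have infE : has_inf E.
  split; first by exists (dot a a), a.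
  by exists 0 => _ [z _ <-]; exact: dot_ge0.
have [_ [y Ay <-] h] := inf_adherent (@ltr01 R) infE.
exists y => // z Az; apply: ltW (lt_le_trans h _); rewrite lerD2r.
by apply: ge_inf; [exact: infE.2 | exists z].
Qed.

(** Without an optimal solution, points of low value and almost minimal norm
    escape to infinity in a direction v.  By the Legendre property the
    normalized points converge strongly, so that a unit step in the direction
    - v shortens these points by almost 1 and does not raise the objective;
    it has to leave F. *)
Lemma legendre_minimizer_or_recession (S : {linear H -> H}) b (F : set H) :
  self_adjoint dot S -> legendre_form dot (quadratic_form dot S) ->
  weakly_closed F -> convex F -> F !=set0 ->
  has_lbound (quadratic_function S b @` F) ->
  (exists2 x, F x &
     forall y, F y -> quadratic_function S b x <= quadratic_function S b y) \/
  (exists v, [/\ recession_direction F v, quadratic_form dot S v = 0 &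
     exists2 z, F z & ~ F (z - v)]).
Proof.
move=> Ssa [Slsc SL] Fcl Fcv F0 fb; set f := quadratic_function S b.
have [x0 Fx0] := F0.
have inff : has_inf (f @` F) by split => //; exists (f x0), x0.
pose m := inf (f @` F).
have mf y : F y -> m <= f y by move=> Fy; apply: ge_inf => //; exists y.
have [[M yM]|unb] := pselect (exists M, forall k : nat,
    exists y, [/\ F y, f y <= m + harmonic k & `|y| <= M]).
  left; have [y yP] := choice yM.
  have [|||x Fx fx] := bounded_minimizing_sequence S b F y m M Slsc Fcl.
  - by move=> k; have [] := yP k.
  - by move=> k; have [] := yP k.
  - by move=> k; have [] := yP k.
  by exists x => // z /mf; exact: le_trans.
right.
have /choice[y yP] : forall n : nat, exists y, [/\ F y, f y <= m + 1,
    n.+1%:R <= `|y| &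
    forall z, F z -> f z <= f y -> dot y y <= dot z z + 1].
  move=> n; have /existsNP[k kP] : ~ forall k : nat,
      exists y, [/\ F y, f y <= m + harmonic k & `|y| <= n.+1%:R].
    by move=> h; apply: unb; exists n.+1%:R.
  have [|y [Fy fy] ymin] :=
    almost_minimal_norm [set y | F y /\ f y <= m + harmonic k].
    have [_ [y Fy <-] /ltW fy] := inf_adherent (@harmonic_gt0 R k) inff.
    by exists y.
  exists y; split=> //.
  - apply: (le_trans fy); rewrite lerD2l.
    by rewrite /harmonic invf_le1 ?ler1n.
  - rewrite leNgt; apply/negP => yn; apply: kP; exists y; split=> //.
    exact: ltW.
  - by move=> z Fz fz; apply: ymin; split=> //; exact: le_trans fz fy.
have y_gt0 k : 0 < `|y k|.
  by have [_ _ h _] := yP k; apply: lt_le_trans h.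
have unit_norm k : `|(`|y k|^-1 *: y k)| = 1.
  by rewrite normrZ normfV normr_id mulVf // gt_eqF.
have [|s [v [ks sv]]] :=
  bounded_weak_subsequence (fun k => `|y k|^-1 *: y k) 1.
  by move=> k; rewrite unit_norm.
pose z k := y (s k); pose w k := `|z k|^-1 *: z k.
have zk k : k.+1%:R <= `|z k|.
  have [_ _ h _] := yP (s k); apply: le_trans h.
  by rewrite ler_nat ltnS.
have Fz k : F (z k) by have [] := yP (s k).
have z0 := large_norm_inv z zk.
have wv : weakly_cvg_to dot w v by exact: sv.
have Fv : recession_direction F v by exact: asymptotic_recession wv.
have Qv_ge0 : 0 <= quadratic_form dot S v.
  suff : 0 <= 2^-1 * quadratic_form dot S v by lra.
  apply: (@quadratic_ge_curvature _ (f x0) (dot (S x0 + b) v) _ m) => t t0.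
  by rewrite -quadratic_functionD //; apply: mf; exact: Fv.
(* [a] bounds the form at [w k] because f (z k) <= m + 1 and
   Q (w k) = 2 (f (z k) - <b, z k>) / |z k|^2. *)
pose a k := 2 * (`|z k|^-1 * (`|z k|^-1 * (m + 1) - dot (w k) b)).
have a0 : a k @[k --> \oo] --> 0.
  have -> : 0 = 2 * (0 * (0 * (m + 1) - dot v b)) by ring.
  apply: cvgM; first exact: cvg_cst.
  apply: cvgM => //; apply: cvgB => //; apply: cvgM => //; exact: cvg_cst.
have Qa k : quadratic_form dot S (w k) <= a k.
  have [_ fz _ _] := yP (s k).
  rewrite /a /w /quadratic_form linearZ /= !dotE -/(z k).
  have zi : 0 <= `|z k|^-1 by rewrite invr_ge0.
  move: fz; rewrite /f /quadratic_function -/(z k) (dotC b) => fz.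
  rewrite [leRHS](_ : _ = `|z k|^-1 * (`|z k|^-1 * (2 * (m + 1 - dot (z k) b)))); last by ring.
  by do 2 apply: ler_wpM2l => //; lra.
have Qv : quadratic_form dot S v = 0.
  apply/eqP; rewrite eq_le Qv_ge0 andbT.
  by apply: (weakly_lsc_le _ _ _ a _ Slsc wv) => //; exact: nearW.
have wv_strong : w k @[k --> \oo] --> v.
  by apply: SL => //; apply: (weakly_lsc_cvg _ _ _ a) => //; rewrite Qv.
have v1 : dot v v = 1.
  rewrite -dot_norm; have /cvg_norm := wv_strong.
  under eq_fun do rewrite unit_norm.
  move=> lim1; suff <- : 1 = `|v| by rewrite expr1n.
  by apply: (cvg_unique (@Rhausdorff R) _ lim1); exact: cvg_cst.
(* If F were invariant under translation by - v, almost minimality of |z k|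
   against z k - v would bound <z k, v> by 1, hence <w k, v> by 1 / |z k|;
   but <w k, v> tends to <v, v> = 1. *)
exists v; split=> //; apply: contrapT => Fshift.
have Fzv k : F (z k - v).
  by apply: contrapT => h; apply: Fshift; exists (z k).
have slope k : 0 <= dot (S (z k) + b) v.
  apply: (@affine_ge_slope _ (f (z k)) _ m) => t t0.
  have := mf _ (Fv _ _ (Fz k) t0).
  by rewrite /f quadratic_functionD // Qv !mulr0 addr0.
have wv_small k : dot (w k) v <= `|z k|^-1.
  have [_ _ _ zmin] := yP (s k).
  have zE : z k - v = z k + (-1) *: v by rewrite scaleN1r.
  have fz : f (z k - v) <= f (z k).
    by rewrite zE /f quadratic_functionD // Qv; have := slope k; lra.
  rewrite /w dotZl ler_piMr ?invr_ge0 //.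
  by have := zmin _ (Fzv k) fz; rewrite -/(z k) !dotE v1 (dotC v); lra.
have lim1 : `|z k|^-1 - dot (w k) v @[k --> \oo] --> (0 - 1 : R).
  by apply: cvgB => //; rewrite -v1; exact: wv.
suff : (0 : R) <= 0 - 1 by lra.
by apply: cvg_ge lim1 _; apply: nearW => k; rewrite subr_ge0.
Qed.

(** * Sublevel sets of convex quadratic functions *)

Section ConvexSublevel.
Variables (S : {linear H -> H}) (b : H) (a : R).
Hypothesis Ssa : self_adjoint dot S.
Hypothesis Spsd : positive_semidefinite dot S.

Let g x := quadratic_function S b x + a.
Let F := [set x | g x <= 0].

Lemma sublevel_weakly_closed : weakly_closed F.
Proof.
move=> u x ux Fu.
suff : quadratic_form dot S x <= 2 * (- a - dot x b).
  by rewrite /F /= /g /quadratic_function /quadratic_form (dotC b); lra.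
apply: (weakly_lsc_le _ _ _ (fun k => 2 * (- a - dot (u k) b)) _
  (psd_weakly_lsc S Ssa Spsd) ux).
  apply: filterS Fu => k.
  by rewrite /F /= /g /quadratic_function /quadratic_form (dotC b); lra.
apply: cvgM; first exact: cvg_cst.
by apply: cvgB; [exact: cvg_cst | exact: ux].
Qed.

Lemma sublevel_convex : convex F.
Proof.
move=> x y t; rewrite /F /= => gx gy /andP[t0 t1].
suff : g ((1 - t) *: x + t *: y) <= (1 - t) * g x + t * g y by nra.
have := Spsd (x - y); rewrite /g /quadratic_function.
rewrite (linearB S) (linearD S) !(linearZ_LR S) /= !dotE.
rewrite -(Ssa y x) (dotC (S y)) => h.
have : 0 <= t * (1 - t) by rewrite mulr_ge0 // subr_ge0.
nra.
Qed.

(** Along v the function g is a quadratic polynomial bounded from above, so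
    its leading coefficient vanishes and its slope is nonpositive. *)
Lemma sublevel_recession v : F !=set0 -> recession_direction F v ->
  S v = 0 /\ dot b v <= 0.
Proof.
move=> [x Fx] Fv.
have gD t : g (x + t *: v) =
    g x + t * dot (S x + b) v + t ^+ 2 * (2^-1 * quadratic_form dot S v).
  by rewrite /g quadratic_functionD //; ring.
have gle t : 0 <= t -> g (x + t *: v) <= 0 by exact: Fv.
have Qv : quadratic_form dot S v = 0.
  suff : 0 <= - (2^-1 * quadratic_form dot S v).
    by have := Spsd v; rewrite /quadratic_form; lra.
  apply: (@quadratic_ge_curvature _ (- g x) (- dot (S x + b) v) _ 0) => t /gle.
  by rewrite gD; lra.
have Sv : S v = 0 by exact: psd_kernel Qv.
split=> //; rewrite -oppr_ge0; apply: (@affine_ge_slope _ (- g x) _ 0) => t /gle.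
by rewrite gD Qv dotDl Ssa Sv dot0r; lra.
Qed.

End ConvexSublevel.

End DotProduct.

(** * Existence of an optimal solution *)

Theorem theorem3p2 (R : realType) (H : completeNormedModType R)
    (dot : {dot H for idfun}) (dot_norm : induces_norm dot)
    (T : {linear H -> H}) (T_cont : continuous T) (T_sa : self_adjoint dot T)
    (T1 : {linear H -> H}) (T1_cont : continuous T1)
    (T1_sa : self_adjoint dot T1) (T1_psd : positive_semidefinite dot T1)
    (c c1 : H) (alpha1 : R) :
  let f := fun x : H => 2^-1 * dot x (T x) + dot c x in
  let g1 := fun x : H => 2^-1 * dot x (T1 x) + dot c1 x + alpha1 in
  let F := [set x : H | g1 x <= 0] in
  legendre_form dot (quadratic_form dot T) ->
  F !=set0 ->
  has_lbound (f @` F) ->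
  exists2 xbar : H, F xbar & forall x, F x -> f xbar <= f x.
Proof.
move=> f g1 F leg F0 [m mf].
have fm y : F y -> m <= f y by move=> Fy; apply: mf; exists y.
have [//|[v [Fv Qv [z Fz nFz]]]] := legendre_minimizer_or_recession dot dot_norm T c F
  T_sa leg (sublevel_weakly_closed dot T1 c1 alpha1 T1_sa T1_psd)
  (sublevel_convex dot T1 c1 alpha1 T1_sa T1_psd) F0 (ex_intro _ m mf).
have [T1v c1v] := sublevel_recession dot dot_norm T1 c1 alpha1 T1_sa T1_psd v F0 Fv.
have g1D y t : g1 (y + t *: v) = g1 y + t * dot c1 v.
  rewrite /g1 [X in X + alpha1](quadratic_functionD dot T1 c1 y v t T1_sa).
  by rewrite /quadratic_form /quadratic_function dotDl T1_sa T1v !dot0r; ring.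
have fD y t : f (y + t *: v) = f y + t * dot (T y + c) v.
  by have := quadratic_functionD dot T c y v t T_sa; rewrite Qv !mulr0 addr0.
have c1v_lt0 : 0 < - dot c1 v.
  rewrite oppr_gt0 lt_neqAle c1v andbT; apply/eqP => c1v0; apply: nFz.
  by rewrite /F /= -scaleN1r g1D c1v0 mulr0 addr0.
(* The step along v that takes y to the boundary g1 = 0. *)
pose s y := g1 y / - dot c1 v.
have g1s y : g1 (y + s y *: v) = 0 by rewrite g1D /s; field; lra.
have slope y : 0 <= dot (T y + c) v.
  apply: (@affine_ge_slope _ (f (y + s y *: v)) _ m) => t t0.
  have : m <= f (y + (s y + t) *: v).
    by apply: fm; rewrite /F /= scalerDl addrA g1D g1s; nra.
  by rewrite !fD; lra.
(* By [slope] the affine function y |-> <y, T v> + <c, v> is nonnegative on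
   the whole space, hence constant. *)
have Tv : T v = 0.
  apply: (dot_eq0 dot dot_norm); apply/eqP; rewrite eq_le dot_ge0 // andbT.
  rewrite -oppr_ge0; apply: (@affine_ge_slope _ (dot c v) _ 0) => t t0.
  have := slope (- t *: T v).
  by rewrite dotDl linearZ /= dotZl T_sa; lra.
have {}fD y t : f (y + t *: v) = f y + t * dot c v.
  by rewrite fD dotDl T_sa Tv dot0r add0r.
pose l := dot c v / - dot c1 v.
have l0 : 0 <= l.
  by apply: divr_ge0; [have := slope 0; rewrite linear0 add0r | exact: ltW].
have shiftE y : f (y + s y *: v) = f y + l * g1 y.
  by rewrite fD /s /l; field; lra.
(* The Lagrangian f + l g1, up to the constant l * alpha1. *)
pose L := quadratic_function dot (T \+ (l \*: T1)) (c + l *: c1).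
have LE y : L y = f y + l * g1 y - l * alpha1.
  rewrite /L /quadratic_function /= /f /g1 !(dotDl, dotDr, dotZl, dotZr).
  by ring.
have [] := legendre_minimizer_or_recession dot dot_norm (T \+ (l \*: T1))
  (c + l *: c1) setT.
- by move=> x y; rewrite /= !(dotDl, dotDr, dotZl, dotZr) T_sa T1_sa.
- exact: legendre_formD.
- by [].
- by [].
- by exists 0.
- exists (m - l * alpha1) => _ [y _ <-]; rewrite -/L LE -shiftE lerD2r.
  by apply: fm; rewrite /F /= g1s.
- move=> [x _ xmin]; exists (x + s x *: v); first by rewrite /F /= g1s.
  move=> y Fy; rewrite shiftE.
  have := xmin y I; rewrite -/L !LE.
  by have : g1 y <= 0 := Fy; nra.
- by move=> [w [_ _ [y _ []]]].
Qed.
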